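(* Let $n \ge 2$ be an integer, let $a_1,a_2,\ldots,a_n \in \mathbb{R}$ with $a_1 < a_2 < \cdots < a_n$, and let $$F(x;a_1,\ldots,a_n) = \frac{n-1}{2} \sum_{j=1}^n \frac{|a_j-x|(a_j-x)^{n-3}}{\prod_{k \neq j}(a_j-a_k)}.$$ If $z \in \mathbb{C}$ and $\mathrm{Re}\,z >-1$, then the function $x \mapsto x^z F(x;a_1,\ldots,a_n)$ is absolutely integrable on $\mathbb{R}$ and $$h_z(a_1,a_2,\ldots,a_n)=\binom{z+n-1}{n-1} \int_{\mathbb{R}} x^z F(x;a_1,a_2,\ldots,a_n)\,dx .$$
   Context: Fix a branch of the complex logarithm defined (and continuous) on $\mathbb{R}\setminus\{0\}$, and for $x\in\mathbb{R}\setminus\{0\}$ and $w\in\mathbb{C}$ put $x^w=e^{w\log x}$. If $\mathrm{Re}\,(z+n-1)>0$, put $0^{z+n-1}:=0$. The value of $x^zF$ at the single point $x=0$, and the values of $F$ at the points $x=a_j$ when $n=2$, are irrelevant for the integral. For pairwise distinct real $a_1,\ldots,a_n$ (at most one of them zero) and $\mathrm{Re}\,z>-1$, the fractional degree complete homogeneous symmetric polynomial $h_z(a_1,\ldots,a_n)$ is defined by $$h_z(a_1,\ldots,a_n)\, V(a_1,\ldots,a_n) = \det\begin{bmatrix} 1 & a_1 & a_1^2 & \cdots & a_1^{n-2} & a_1^{z+n-1} \\ 1 & a_2 & a_2^2 & \cdots & a_2^{n-2} & a_2^{z+n-1} \\ \vdots & \vdots & \vdots & \ddots & \vdots & \vdots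 \\ 1 & a_n & a_n^2 & \cdots & a_n^{n-2} & a_n^{z+n-1} \end{bmatrix},$$ where $V(a_1,\ldots,a_n)=\prod_{1\le i<j\le n}(a_j-a_i)$ is the Vandermonde determinant. For complex $z$, $$\binom{z+n-1}{n-1}=\frac{(z+n-1)(z+n-2)\cdots(z+1)}{(n-1)!}.$$ *)

(* Defs.v *)
From mathcomp Require Import all_boot all_order all_algebra.
From mathcomp Require Import all_classical all_reals all_analysis.
From mathcomp Require Import complex.

Set Implicit Arguments.
Unset Strict Implicit.
Unset Printing Implicit Defensive.

Import Order.TTheory GRing.Theory Num.Theory.
Import numFieldNormedType.Exports.

Local Open Scope classical_set_scope.
Local Open Scope ring_scope.
Local Open Scope complex_scope.

Definition cexp (R : realType) (w : R[i]) : R[i] :=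
  (expR (complex.Re w))%:C *
  (cos (complex.Im w) +i* sin (complex.Im w)).

(* The two half-lines are separate components of the domain, so the branches
   on them are not tied to each other. The value [L 0] is arbitrary. *)
Definition is_log_branch (R : realType) (L : R -> R[i]) : Prop :=
  forall x : R, x != 0 ->
    cexp (L x) = x%:C /\ {for x, continuous (L : R -> (R[i])^o)}.

(* At the base [0] this is only meaningful when [Re w > 0]. *)
Definition cpow (R : realType) (L : R -> R[i]) (x : R) (w : R[i]) : R[i] :=
  if x == 0 then 0 else cexp (w * L x).

Definition cbinom (R : realType) (w : R[i]) (k : nat) : R[i] :=
  (\prod_(i < k) (w - i%:R)) / (k`!)%:R.

Definition cintegrable (R : realType) (f : R -> R[i]) : Prop :=
  [/\ measurable_fun [set: R] (fun x => complex.Re (f x)),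
      measurable_fun [set: R] (fun x => complex.Im (f x)) &
      (\int[lebesgue_measure]_x (Normc.normc (f x))%:E < +oo)%E].

Definition cintegral (R : realType) (f : R -> R[i]) : R[i] :=
  (\int[lebesgue_measure]_x complex.Re (f x))%R +i*
  (\int[lebesgue_measure]_x complex.Im (f x))%R.

Definition vandermonde_prod (R : realType) (n : nat) (a : 'I_n -> R) : R :=
  \prod_(i < n) \prod_(j < n | (i < j)%N) (a j - a i).

Definition frac_vandermonde (R : realType) (n : nat) (a : 'I_n -> R)
    (L : R -> R[i]) (z : R[i]) : 'M[R[i]]_n :=
  \matrix_(i < n, j < n)
    if (j < n.-1)%N then (a i)%:C ^+ j else cpow L (a i) (z + n%:R - 1).

(* Division by the Vandermonde product is meaningful for distinct [a i]. *)
Definition frac_hsym (R : realType) (n : nat) (a : 'I_n -> R)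
    (L : R -> R[i]) (z : R[i]) : R[i] :=
  \det (frac_vandermonde a L z) / (vandermonde_prod a)%:C.

(* The exponent [n - 3] is an integer: it is [-1] for [n = 2], where the value
   at [x = a j] is then irrelevant. *)
Definition spline (R : realType) (n : nat) (a : 'I_n -> R) (x : R) : R :=
  (n%:R - 1) / 2 *
  \sum_(j < n)
    `|a j - x| * (a j - x) ^ (n%:Z - 3) / \prod_(k < n | k != j) (a j - a k).

(* Main.v *)
Require Import Defs.
From mathcomp Require Import all_boot all_order all_algebra.
From mathcomp Require Import all_classical all_reals all_analysis.
From mathcomp Require Import measurable_realfun complex ring lra.

(* Write t_j = a_j - x and c_j = 1 / prod_(k != j) (a_j - a_k), and let H be the
   unit step. Interpolating the last column of the determinant at the a_j gives
   h_z(a) = sum_j c_j a_j^(z+n-1). The same interpolation shows that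
   sum_j c_j t_j^(n-2) = 0, so that F can be rewritten both as
   (n-1) sum_j c_j H(t_j) t_j^(n-2), which is used for x > 0, and as
   -(n-1) sum_j c_j H(-t_j) t_j^(n-2), which is used for x < 0. After splitting
   the integral at 0, the term of index j is therefore an Euler beta integral
   over the interval between 0 and a_j, and it contributes c_j a_j^(z+n-1)
   divided by the binomial coefficient. With an integer second argument, the
   beta integral follows by induction from
   x^w (a-x)^(m+1) = a x^w (a-x)^m - x^(w+1) (a-x)^m
   and from the integral of x^w. The branch of the logarithm is locally
   ln |x| plus a constant, hence it only contributes one constant factor on each
   half-line. *)

Set Implicit Arguments.
Unset Strict Implicit.
Unset Printing Implicit Defensive.

Import Order.TTheory GRing.Theory Num.Theory.
Import numFieldNormedType.Exports.

Local Open Scope classical_set_scope.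
Local Open Scope ring_scope.
Local Open Scope complex_scope.

Local Notation Re := complex.Re.
Local Notation Im := complex.Im.

(** * Determinants and divided differences *)

(** The matrix is the transpose of a product of [T] with a Vandermonde matrix, where [T] is the
    identity with its last row replaced by the coefficients of [p]. As [T] is triangular, it only
    contributes its last diagonal entry. *)
Lemma det_vandermonde_last_poly (F : comNzRingType) (m : nat) (x : 'I_m.+1 -> F)
    (p : {poly F}) : (size p <= m.+1)%N ->
  \det (\matrix_(i < m.+1, j < m.+1) if (j < m)%N then x i ^+ j else p.[x i]) =
  p`_m * \prod_(i < m.+1) \prod_(j < m.+1 | (i < j)%N) (x j - x i).
Proof.
move=> sp.
pose T : 'M[F]_m.+1 := \matrix_(i, j) if (i < m)%N then (i == j)%:R else p`_j.
set M := (X in \det X).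
have -> : M = (T *m Vandermonde m.+1 (\row_i x i))^T.
  apply/matrixP => i j; rewrite !mxE.
  case: ifP => jm.
    rewrite (bigD1 j)//= !mxE jm eqxx mul1r big1 ?addr0// => k /negbTE kj.
    by rewrite !mxE jm eq_sym kj mul0r.
  rewrite (horner_coef_wide _ sp); apply: eq_bigr => k _.
  by rewrite !mxE jm.
rewrite det_tr det_mulmx det_Vandermonde det_trig; last first.
  apply/is_trig_mxP => i j ij; rewrite !mxE.
  have im : (i < m)%N by rewrite (leq_trans ij)// -ltnS.
  by rewrite im -val_eqE /= ltn_eqF.
congr (_ * _).
  rewrite big_ord_recr/= big1 ?mul1r => [|i _].
    by rewrite !mxE/= ltnn.
  by rewrite !mxE/= ltn_ord eqxx.
by apply: eq_bigr => i _; apply: eq_bigr => j _; rewrite !mxE.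
Qed.

Section divided_difference.
Context {F : fieldType} {m : nat} {x : 'I_m.+1 -> F} (xI : injective x).

(** Lagrange basis polynomial, left monic: its value at its own node becomes the denominator of the
    weight. *)
Let lag (i : 'I_m.+1) : {poly F} :=
  \prod_(k < m.+1 | k != i) ('X - (x k)%:P).

Let size_lag i : size (lag i) = m.+1.
Proof.
rewrite /lag -big_filter size_prod_XsubC; congr _.+1.
by rewrite -sum1_size big_filter sum1_card cardC1 card_ord.
Qed.

Let lagE i j : (lag i).[x j] =
  (\prod_(k < m.+1 | k != i) (x i - x k)) *+ (i == j).
Proof.
rewrite horner_prod; have [<-|ij] := eqVneq i j.
  by apply: eq_bigr => k _; rewrite hornerXsubC.
by rewrite (bigD1 j) 1?eq_sym//= hornerXsubC subrr mul0r.
Qed.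

Let prod_neq0 i : \prod_(k < m.+1 | k != i) (x i - x k) != 0.
Proof.
by apply/prodf_neq0 => k ki; rewrite subr_eq0 inj_eq// eq_sym.
Qed.

(** The last column is matched by the Lagrange interpolant [p]. Since each [lag i] is monic of
    degree m, the coefficient of [p] in degree m is the sum of the weighted values. *)
Lemma det_vandermonde_last (c : 'I_m.+1 -> F) :
  \det (\matrix_(i < m.+1, j < m.+1) if (j < m)%N then x i ^+ j else c i) =
  (\sum_(i < m.+1) c i / \prod_(k < m.+1 | k != i) (x i - x k)) *
  \prod_(i < m.+1) \prod_(j < m.+1 | (i < j)%N) (x j - x i).
Proof.
pose p := \sum_i (c i / \prod_(k < m.+1 | k != i) (x i - x k)) *: lag i.
have pE i : p.[x i] = c i.
  rewrite /p horner_sum (bigD1 i)//= [X in _ + X]big1 => [|j ji].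
    by rewrite hornerZ lagE eqxx addr0 mulr1n divfK.
  by rewrite hornerZ lagE (negbTE ji) mulr0n mulr0.
  have sp : (size p <= m.+1)%N.
  apply: (leq_trans (size_sum _ _ _)); apply/bigmax_leqP => i _.
  by rewrite (leq_trans (size_scale_leq _ _))// size_lag.
have -> : \sum_(i < m.+1) c i / \prod_(k < m.+1 | k != i) (x i - x k) = p`_m.
  rewrite coef_sum; apply: eq_bigr => i _; rewrite coefZ.
  have /monicP : lag i \is monic by exact: monic_prod_XsubC.
  by rewrite /lead_coef size_lag/= => ->; rewrite mulr1.
rewrite -(det_vandermonde_last_poly x sp); congr (\det _).
by apply/matrixP => i j; rewrite !mxE pE.
Qed.

(** Both evaluations of the same determinant are compared: the coefficient in degree m is 0, and the
    Vandermonde product cancels because the nodes are distinct. *)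
Lemma divided_difference_poly (p : {poly F}) : (size p <= m)%N ->
  \sum_(i < m.+1) p.[x i] / \prod_(k < m.+1 | k != i) (x i - x k) = 0.
Proof.
move=> sp; have := det_vandermonde_last_poly x (leqW sp).
rewrite det_vandermonde_last nth_default// mul0r => /eqP.
rewrite mulf_eq0 => /orP[/eqP//|/prodf_eq0[i _ /prodf_eq0[j ij]]].
by rewrite subr_eq0 => /eqP/xI ji; rewrite ji ltnn in ij.
Qed.

End divided_difference.

(** * Integrals of powers over open intervals *)

Section improper_FTC2.
Context {R : realType}.
Notation mu := (@lebesgue_measure R).
Implicit Types (f F g G : R -> R) (a b : R).

(** Nothing is asked of [f] at the endpoints, where it may blow up, as x^u does at 0 for u < 0; [F]
    only needs its one-sided limits there. *)
Definition primitive_oo a b f F :=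
  [/\ {in `]a, b[, forall x, {for x, continuous f}},
      {in `]a, b[, forall x, is_derive x (1 : R) F (f x)},
      F x @[x --> a^'+] --> F a & F x @[x --> b^'-] --> F b].

(** The usual fundamental theorem applies on the compact intervals [E n], which exhaust the open
    one. The integrals converge by monotone convergence, the increments by the endpoint limits of
    [F]. *)
Lemma ge0_FTC2_oo f F a b : a < b -> primitive_oo a b f F ->
  {in `]a, b[, forall x, 0 <= f x} ->
  (\int[mu]_(x in `]a, b[) (f x)%:E = (F b - F a)%:E)%E.
Proof.
move=> ab [cf dF Fa Fb] f0.
(* The denominator n + 3 gives 3 d_n <= b - a, so [E n] is nondegenerate already for n = 0. *)
pose d n : R := (b - a) / n.+3%:R.
have d_gt0 n : 0 < d n by rewrite divr_gt0 ?subr_gt0.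
have d_cvg : d n @[n --> \oo] --> 0.
  rewrite -[0](mulr0 (b - a)); apply: cvgMr.
  rewrite (_ : (fun n => _) = [sequence harmonic (n + 2)%N]_n) ?cvg_shiftn.
    exact: cvg_harmonic.
  by apply/funext => n /=; rewrite addn2.
have d_lt n : a + d n < b - d n.
  have : 3%:R * d n <= b - a.
    have -> : b - a = n.+3%:R * d n by rewrite mulrCA divff ?mulr1.
    by rewrite ler_pM2r// ler_nat.
  by have := d_gt0 n; lra.
have mf : measurable_fun `]a, b[ f.
  apply: open_continuous_measurable_fun; first exact: interval_open.
  by move=> x; rewrite inE; exact: cf.
pose E n : set R := `[a + d n, b - d n]%classic.
have Eoo n x : x \in E n -> x \in `]a, b[.
  rewrite inE /E/= !in_itv/= => /andP[ax xb].
  by have := d_gt0 n; lra.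
have EE : `]a, b[%classic = \bigcup_n E n.
  apply/seteqP; split => [x|x [n _]] /=; last by rewrite -inE; exact: Eoo.
  rewrite in_itv/= => /andP[ax xb].
  have [n _ /(_ n (leqnn n)) dn] :
      \forall n \near \oo, d n < Num.min (x - a) (b - x).
    have m0 : 0 < Num.min (x - a) (b - x) by rewrite lt_min !subr_gt0 ax.
    exact: (cvgr_lt _ d_cvg _ m0).
  exists n => //=; rewrite /E/= in_itv/=.
  by move: dn => /=; rewrite lt_min => /andP[? ?]; lra.
have ndE : nondecreasing_seq E.
  apply/nondecreasing_seqP => n; apply/subsetPset => x.
  rewrite /E/= !in_itv/=.
  have : d n.+1 <= d n.
    by rewrite /d ler_pM2l ?subr_gt0// lef_pV2 ?posrE// ler_nat.
  by move=> ? /andP[? ?]; apply/andP; split; lra.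
have -> : (\int[mu]_(x in `]a, b[) (f x)%:E =
    \int[mu]_(x in \bigcup_n E n) (f x)%:E)%E by rewrite -EE.
have : (\int[mu]_(x in E n) (f x)%:E @[n --> \oo] -->
        \int[mu]_(x in \bigcup_n E n) (f x)%:E)%E.
  apply: ge0_nondecreasing_set_cvg_integral => //.
  - by move=> n; exact: measurable_itv.
  - move=> n; apply/measurable_EFinP; apply: measurable_funS mf => //.
    by move=> x; rewrite -inE => /Eoo.
  - by move=> n x; rewrite -inE => /Eoo; rewrite lee_fin; exact: f0.
have -> : (fun n => (\int[mu]_(x in E n) (f x)%:E)%E) =
    (fun n => (F (b - d n) - F (a + d n))%:E).
  apply/funext => n; rewrite EFinB.
  apply: continuous_FTC2 => //.
  - apply: continuous_in_subspaceT => x xE; apply: cf; exact: (Eoo n).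
  - have cF x : x \in E n -> F @ x --> F x.
      move=> /Eoo/dF dx; apply: differentiable_continuous.
      exact/derivable1_diffP.
    split.
    + move=> x xE; have : x \in E n.
        by rewrite inE; exact: subset_itv_oo_cc.
      by move=> /Eoo/dF dx; exact: ex_derive.
    + apply: cvg_at_right_filter; apply: cF.
      by rewrite inE /E/= in_itv/= lexx ltW.
    + apply: cvg_at_left_filter; apply: cF.
      by rewrite inE /E/= in_itv/= lexx ltW.
  - move=> x xE; have : x \in E n.
      by rewrite inE; exact: subset_itv_oo_cc.
    by move=> /Eoo/dF dx; rewrite derive1E; exact: derive_val.
move=> /cvg_unique; apply => //; apply: cvg_EFin; first exact: nearW.
apply: cvgB.
- move/cvg_at_leftP: Fb; apply; split => [n|]; first by rewrite gtrBl.
  by rewrite -[X in _ --> X]subr0; apply: cvgB => //; exact: cvg_cst.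
- move/cvg_at_rightP: Fa; apply; split => [n|]; first by rewrite ltrDl.
  by rewrite -[X in _ --> X]addr0; apply: cvgD => //; exact: cvg_cst.
Qed.

Lemma primitive_ooD f F g G a b :
  primitive_oo a b f F -> primitive_oo a b g G ->
  primitive_oo a b (f \+ g) (F \+ G).
Proof.
move=> [cf dF Fa Fb] [cg dG Ga Gb]; split.
- by move=> x xab; apply: continuousD; [exact: cf|exact: cg].
- by move=> x xab; apply: is_deriveD; [exact: dF|exact: dG].
- exact: cvgD.
- exact: cvgD.
Qed.

Lemma ge0_integrable_oo f F a b : a < b -> primitive_oo a b f F ->
  {in `]a, b[, forall x, 0 <= f x} ->
  mu.-integrable `]a, b[ (EFin \o f).
Proof.
move=> ab pf f0; have [cf _ _ _] := pf; apply/integrableP; split.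
  apply/measurable_EFinP; apply: open_continuous_measurable_fun.
    exact: interval_open.
  by move=> x; rewrite inE; exact: cf.
have -> : (\int[mu]_(x in `]a, b[) `|(EFin \o f) x| =
    \int[mu]_(x in `]a, b[) (f x)%:E)%E.
  by apply: eq_integral => x; rewrite inE => /= /f0 fx0; rewrite ger0_norm.
by rewrite (ge0_FTC2_oo ab pf)// ltry.
Qed.

(* [f = (f + g) - g] reduces the claim to the nonnegative case. *)
Lemma dominated_FTC2_oo f F g G a b : a < b ->
  primitive_oo a b f F -> primitive_oo a b g G ->
  {in `]a, b[, forall x, `|f x| <= g x} ->
  mu.-integrable `]a, b[ (EFin \o f) /\
  \int[mu]_(x in `]a, b[) f x = F b - F a.
Proof.
move=> ab pf pg fg.
have g0 : {in `]a, b[, forall x, 0 <= g x}.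
  by move=> x /fg; exact: le_trans.
have ig := ge0_integrable_oo ab pg g0.
have if_ : mu.-integrable `]a, b[ (EFin \o f).
  apply: le_integrable ig => //.
    have [cf _ _ _] := pf.
    apply/measurable_EFinP; apply: open_continuous_measurable_fun.
      exact: interval_open.
    by move=> x; rewrite inE; exact: cf.
  by move=> x xab /=; rewrite lee_fin (ger0_norm (g0 _ xab)) fg.
split=> //.
have fg0 : {in `]a, b[, forall x, 0 <= (f \+ g) x}.
  by move=> x /fg; rewrite ler_norml => /andP[+ _] /=; lra.
have /(congr1 fine) := ge0_FTC2_oo ab (primitive_ooD pf pg) fg0.
have /(congr1 fine) := ge0_FTC2_oo ab pg g0.
rewrite -!/(Rintegral _ _ _) RintegralD// => -> /=; lra.
Qed.

(** Transfers results from (0, b) to (-b, 0); the sign of the new primitive compensates the chain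
    rule. *)
Lemma primitive_oo_opp f F a b : primitive_oo a b f F ->
  primitive_oo (- b) (- a) (fun x => f (- x)) (fun x => - F (- x)).
Proof.
have opp_itv x : x \in `]- b, - a[ -> - x \in `]a, b[.
  by rewrite !in_itv/= ltrNl ltrNr andbC.
move=> [cf dF Fa Fb]; split.
- move=> x xab; apply: continuous_comp; first exact: continuousN.
  exact/cf/opp_itv.
- move=> x xab.
  have dFx := dF _ (opp_itv _ xab).
  have -> : f (- x) = - (f (- x) * - 1) by lra.
  have dN : is_derive x (1 : R) (-%R : R -> R) (- 1).
    exact: is_deriveNid.
  have dFN : is_derive x (1 : R) (F \o (-%R : R -> R)) (f (- x) * - 1).
    exact: is_derive1_comp.
  exact: is_deriveN dFN.
- rewrite opprK; apply: cvgN.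
  exact/(cvg_at_leftNP F b).
- rewrite opprK; apply: cvgN.
  exact/(cvg_at_rightNP F a).
Qed.
End improper_FTC2.

(** * Integrals of x^u cos(v ln x) and x^u sin(v ln x) *)

Section power_primitive.
Context {R : realType}.
Notation mu := (@lebesgue_measure R).

(** These are the real combinations of the real and imaginary parts of t^(p+iv); differentiation
    keeps the family, lowering p by 1 and acting linearly on (c, s). *)
Lemma is_derive_powR_cos_sin (p v c s x : R) : 0 < x ->
  is_derive x (1 : R)
    (fun t => t `^ p * (c * cos (v * ln t) + s * sin (v * ln t)))
    (x `^ (p - 1) * ((p * c + v * s) * cos (v * ln x) +
                     (p * s - v * c) * sin (v * ln x))).
Proof.
move=> x0.
have dln : is_derive x (1 : R) (fun t : R => v * ln t) (v * x^-1).
  exact: (is_deriveZ v (is_derive1_ln x0)).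
have dcos : is_derive x (1 : R) (cos \o (fun t : R => v * ln t))
    (- sin (v * ln x) * (v * x^-1)).
  exact: is_derive1_comp.
have dsin : is_derive x (1 : R) (sin \o (fun t : R => v * ln t))
    (cos (v * ln x) * (v * x^-1)).
  exact: is_derive1_comp.
have dpow : is_derive x (1 : R) (@powR R ^~ p) (p * x `^ (p - 1)).
  exact: is_derive1_powR.
have dsum := is_deriveD (is_deriveZ c dcos) (is_deriveZ s dsin).
apply: (is_derive_eq (is_deriveM dpow dsum)).
have xp : x `^ p = x `^ (p - 1) * x.
  by rewrite -[X in _ * X]powRr1 ?ltW// -powRD ?subrK// (gt_eqF x0) implybT.
rewrite !fctE xp.
rewrite /GRing.scale /= -[c *: _]/(c * _) -[s *: _]/(s * _); field.
by rewrite gt_eqF.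
Qed.

Lemma continuous_powR_cos_sin (p v c s x : R) : 0 < x ->
  {for x, continuous (fun t : R =>
    t `^ p * (c * cos (v * ln t) + s * sin (v * ln t)))}.
Proof.
move=> /(is_derive_powR_cos_sin p v c s) d.
by apply: differentiable_continuous; exact/derivable1_diffP.
Qed.

Lemma norm_cos_sin (c s t : R) : `|c * cos t + s * sin t| <= `|c| + `|s|.
Proof.
apply: (le_trans (ler_normD _ _)); rewrite !normrM lerD//.
  by rewrite ler_piMr// ler_norml cos_geN1 cos_le1.
by rewrite ler_piMr// ler_norml sin_geN1 sin_le1.
Qed.

(** At 0 the trigonometric factor is bounded and x^p tends to 0, which squeezes the primitive to its
    value there. *)
Lemma primitive_powR_cos_sin (p v c s b : R) : 0 < p -> 0 < b ->
  primitive_oo 0 b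
    (fun x => x `^ (p - 1) * ((p * c + v * s) * cos (v * ln x) +
                              (p * s - v * c) * sin (v * ln x)))
    (fun x => x `^ p * (c * cos (v * ln x) + s * sin (v * ln x))).
Proof.
move=> p0 b0.
have itv0 x : x \in `]0, b[ -> 0 < x by rewrite in_itv/= => /andP[].
split.
- by move=> x /itv0; exact: continuous_powR_cos_sin.
- by move=> x /itv0; exact: is_derive_powR_cos_sin.
- rewrite powR0 ?gt_eqF// mul0r.
  apply/norm_cvg0P.
  apply: (@squeeze_cvgr _ _ _ _ (cst 0) (fun x => x `^ p * (`|c| + `|s|))).
  + apply: nearW => x /=; rewrite normr_ge0/= normrM ger0_norm ?powR_ge0//.
    by rewrite ler_wpM2l ?powR_ge0// norm_cos_sin.
  + exact: cvg_cst.
  + rewrite -[X in _ --> X](mul0r (`|c| + `|s|)).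
    by apply: cvgMl; exact: powR_cvg0.
- apply: cvg_at_left_filter; exact: continuous_powR_cos_sin.
Qed.

(** The coefficients in [I] solve p c + v s = al, p s - v c = be, a system of determinant [D]: this
    is division by p + iv in real coordinates. *)
Lemma integral_powR_cos_sin (u v al be b : R) : -1 < u -> 0 < b ->
  let f x := x `^ u * (al * cos (v * ln x) + be * sin (v * ln x)) in
  let p := u + 1 in let D := p ^+ 2 + v ^+ 2 in
  mu.-integrable `]0, b[ (EFin \o f) /\
  mu.-integrable `]- b, 0[ (EFin \o (fun x => f (- x))) /\
  let I := b `^ p * ((p * al - v * be) / D * cos (v * ln b) +
                     (p * be + v * al) / D * sin (v * ln b)) in
  \int[mu]_(x in `]0, b[) f x = I /\
  \int[mu]_(x in `]- b, 0[) f (- x) = I.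
Proof.
move=> u1 b0 f p D.
have p0 : 0 < p by rewrite /p; lra.
have D0 : 0 < D by rewrite ltr_pwDl ?exprn_gt0 ?sqr_ge0.
have pf := @primitive_powR_cos_sin p v
  ((p * al - v * be) / D) ((p * be + v * al) / D) b p0 b0.
have {}pf : primitive_oo 0 b f
    (fun x => x `^ p * ((p * al - v * be) / D * cos (v * ln x) +
                        (p * be + v * al) / D * sin (v * ln x))).
  move: pf; congr primitive_oo; apply/funext => x; rewrite /f.
  have -> : p - 1 = u by rewrite /p addrK.
  congr (_ * (_ * _ + _ * _)); rewrite /D; field; exact: lt0r_neq0.
(* Frequency 0 turns the same primitive into one of (|al| + |be|) x^u, which dominates [f]. *)
have pg := @primitive_powR_cos_sin p 0 ((`|al| + `|be|) / p) 0 b p0 b0.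
set G := (X in primitive_oo _ _ _ X) in pg.
set g := (X in primitive_oo _ _ X _) in pg.
have fg x : `|f x| <= g x.
  rewrite /f/g normrM ger0_norm ?powR_ge0// {1}/p addrK ler_wpM2l ?powR_ge0//.
  rewrite !mul0r cos0 sin0 !mulr0 !addr0 mulr1 mulrCA divff ?lt0r_neq0// mulr1.
  exact: norm_cos_sin.
have F0 (x : R) : (0 : R) `^ p * x = 0.
  by rewrite powR0 ?mul0r// lt0r_neq0.
have [if1 If1] := dominated_FTC2_oo b0 pf pg (fun x _ => fg x).
have b0' : - b < - 0 by rewrite oppr0 oppr_lt0.
have [if2 If2] := dominated_FTC2_oo b0' (primitive_oo_opp pf)
  (primitive_oo_opp pg) (fun x _ => fg (- x)).
move: if2 If2; rewrite oppr0 => if2 If2.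
split=> //; split=> //; split.
  by rewrite If1 F0 subr0.
by rewrite If2 !opprK oppr0 F0 oppr0 add0r.
Qed.
End power_primitive.

(** * Complex-valued integrals *)

Section complex_integral.
Context {R : realType}.
Notation mu := (@lebesgue_measure R).
Implicit Types (f g : R -> R[i]) (v w c : R[i]).

(** Integrability and value are bundled, so that linearity proves both claims of the theorem at
    once. *)
Definition has_cintegral f v :=
  [/\ mu.-integrable setT (EFin \o (fun x => Re (f x))),
      mu.-integrable setT (EFin \o (fun x => Im (f x))) &
      cintegral f = v].

Lemma has_cintegralD f g v w : has_cintegral f v -> has_cintegral g w ->
  has_cintegral (fun x => f x + g x) (v + w).
Proof.
move=> [fR fI <-] [gR gI <-].
have RD : (fun x => Re (f x + g x)) =
    (fun x => Re (f x)) \+ (fun x => Re (g x)).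
  by apply/funext => x /=; case: (f x) (g x) => ? ? [].
have ID : (fun x => Im (f x + g x)) =
    (fun x => Im (f x)) \+ (fun x => Im (g x)).
  by apply/funext => x /=; case: (f x) (g x) => ? ? [].
rewrite /has_cintegral /cintegral RD ID; split.
- exact: (integrableD measurableT fR gR).
- exact: (integrableD measurableT fI gI).
- by rewrite !RintegralD.
Qed.

Lemma has_cintegralZ f v c : has_cintegral f v ->
  has_cintegral (fun x => c * f x) (c * v).
Proof.
move=> [fR fI <-]; case: c => a b.
have RZ : (fun x => Re ((a +i* b) * f x)) =
    (fun x => a * Re (f x)) \+ (fun x => (- b) * Im (f x)).
  by apply/funext => x /=; case: (f x) => ? ? /=; rewrite mulNr.
have IZ : (fun x => Im ((a +i* b) * f x)) =
    (fun x => a * Im (f x)) \+ (fun x => b * Re (f x)).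
  by apply/funext => x /=; case: (f x) => ? ? /=.
have iZ k (h : R -> R) : mu.-integrable setT (EFin \o h) ->
    mu.-integrable setT (EFin \o (fun x => k * h x)).
  by move=> ih; exact: (integrableZl measurableT k ih).
rewrite /has_cintegral /cintegral RZ IZ; split.
- exact: (integrableD measurableT (iZ _ _ fR) (iZ _ _ fI)).
- exact: (integrableD measurableT (iZ _ _ fI) (iZ _ _ fR)).
- rewrite !RintegralD//; do ?exact: iZ.
  rewrite !RintegralZl//.
  by congr Complex; rewrite mulNr.
Qed.

Lemma has_cintegral_eq f g v w : f =1 g -> v = w ->
  has_cintegral f v -> has_cintegral g w.
Proof. by move=> /funext -> ->. Qed.

Lemma has_cintegral0 : has_cintegral (fun=> 0) 0.
Proof.
split.
- exact: integrable0.
- exact: integrable0.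
- by rewrite /cintegral /=; congr Complex; rewrite Rintegral_cst// mul0r.
Qed.

Lemma has_cintegral_sum (I : Type) (r : seq I) (P : pred I) (F : I -> R -> R[i])
    (V : I -> R[i]) : (forall i, P i -> has_cintegral (F i) (V i)) ->
  has_cintegral (fun x => \sum_(i <- r | P i) F i x) (\sum_(i <- r | P i) V i).
Proof.
move=> FV; elim: r => [|i r IH].
  by apply: has_cintegral_eq has_cintegral0 => [x|]; rewrite big_nil.
case Pi: (P i); last first.
  by apply: has_cintegral_eq IH => [x|]; rewrite big_cons Pi.
apply: has_cintegral_eq (has_cintegralD (FV _ Pi) IH) => [x|].
  by rewrite big_cons Pi.
by rewrite big_cons Pi.
Qed.

Lemma has_cintegral_restrict (D : set R) f : measurable D ->
  mu.-integrable D (EFin \o (fun x => Re (f x))) ->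
  mu.-integrable D (EFin \o (fun x => Im (f x))) ->
  has_cintegral (fun x => if x \in D then f x else 0)
    ((\int[mu]_(x in D) Re (f x)) +i* (\int[mu]_(x in D) Im (f x))).
Proof.
move=> mD iR iI.
have RE : (fun x => Re (if x \in D then f x else 0)) = (fun x => Re (f x)) \_ D.
  by apply/funext => x; rewrite patchE; case: ifP.
have IE : (fun x => Im (if x \in D then f x else 0)) = (fun x => Im (f x)) \_ D.
  by apply/funext => x; rewrite patchE; case: ifP.
rewrite /has_cintegral /cintegral RE IE; split.
- by rewrite -restrict_EFin; apply/integrable_restrict => //; rewrite setTI.
- by rewrite -restrict_EFin; apply/integrable_restrict => //; rewrite setTI.
- by rewrite -!Rintegral_mkcond.
Qed.

(** Absorbs the value 1/2 that [step] takes at the jump. *)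
Lemma has_cintegral_point (a : R) c :
  has_cintegral (fun x => if x == a then c else 0) 0.
Proof.
have iP (r : R) : mu.-integrable [set a] (EFin \o (fun _ : R => r)).
  apply/integrableP; split; first exact: measurable_cst.
  by rewrite (@integral_Sset1 _ _ _ a).
apply: has_cintegral_eq
  (has_cintegral_restrict (f := fun=> c) (measurable_set1 a) (iP _) (iP _)).
- by move=> x; rewrite in_set1.
- by rewrite !Rintegral_set1.
Qed.

(** The modulus is at most |Re f| + |Im f|, which is integrable. *)
Lemma has_cintegral_cintegrable f v : has_cintegral f v -> cintegrable f.
Proof.
move=> [fR fI _].
have mR : measurable_fun setT (fun x => Re (f x)).
  by apply/measurable_EFinP; exact: measurable_int fR.
have mI : measurable_fun setT (fun x => Im (f x)).
  by apply/measurable_EFinP; exact: measurable_int fI.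
split=> //.
have iD := integrableD measurableT (integrable_abse fR) (integrable_abse fI).
have : (\int[mu]_x (`|Re (f x)|%:E + `|Im (f x)|%:E) < +oo)%E.
  have /integrableP[_] := iD.
  apply: le_lt_trans; rewrite le_eqVlt; apply/orP; left; apply/eqP.
  by apply: eq_integral => x _; rewrite gee0_abs//= -EFinD lee_fin addr_ge0.
apply: le_lt_trans; apply: ge0_le_integral => //.
- by move=> x _; rewrite lee_fin; case: (f x) => ? ? /=; rewrite sqrtr_ge0.
- apply/measurable_EFinP.
  have -> : (fun x => Normc.normc (f x)) =
      Num.sqrt \o ((fun x => Re (f x) ^+ 2) \+ (fun x => Im (f x) ^+ 2)).
    by apply/funext => x /=; case: (f x).
  apply: measurableT_comp.
    by apply: continuous_measurable_fun => x; exact: (@sqrt_continuous R x).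
  by apply: measurable_funD; apply: measurable_funX.
- by apply: emeasurable_funD; apply/measurable_EFinP; apply: measurableT_comp.
- move=> x _; rewrite -EFinD lee_fin; case: (f x) => s t /=.
  rewrite -[leRHS]ger0_norm ?addr_ge0// -sqrtr_sqr ler_sqrt ?sqr_ge0//.
  rewrite sqrrD !real_normK ?num_real// -addrA lerD2l lerDr.
  by rewrite mulrn_wge0// mulr_ge0.
Qed.

End complex_integral.

(** * Complex powers on a half-line and their truncated integrals *)

Section complex_power.
Context {R : realType}.
Notation mu := (@lebesgue_measure R).
Implicit Types (x a : R) (w : R[i]).

Lemma cexpD (w1 w2 : R[i]) : cexp (w1 + w2) = cexp w1 * cexp w2.
Proof.
case: w1 => u1 v1; case: w2 => u2 v2; rewrite /cexp/= expRD sinD cosD.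
by apply/eqP; rewrite eq_complex /=; apply/andP; split; apply/eqP; ring.
Qed.

Lemma cexp0 : cexp (0 : R[i]) = 1.
Proof. by rewrite /cexp /= expR0 cos0 sin0 mul1r. Qed.

Lemma cexpMn (n : nat) w : cexp (n%:R * w) = cexp w ^+ n.
Proof.
elim: n => [|n IH]; first by rewrite mul0r cexp0 expr0.
by rewrite -natr1 mulrDl mul1r cexpD IH exprSr.
Qed.

(** Principal power extended by 0, so that [ppow x] and [ppow (- x)] carry the two half-lines
    without case distinctions. *)
Definition ppow x w : R[i] := if 0 < x then cexp (w * (ln x)%:C) else 0.

Lemma ppow_gt0 x w : 0 < x -> ppow x w = cexp (w * (ln x)%:C).
Proof. by rewrite /ppow => ->. Qed.

Lemma ppow_le0 x w : x <= 0 -> ppow x w = 0.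
Proof. by rewrite /ppow ltNge => ->. Qed.

Lemma ppowD1 x w : ppow x (w + 1) = x%:C * ppow x w.
Proof.
rewrite /ppow; case: ifPn => x0; last by rewrite mulr0.
rewrite mulrDl mul1r cexpD mulrC; congr (_ * _).
by rewrite /cexp /= lnK ?posrE// cos0 sin0 mulr1.
Qed.

Lemma Re_ppow x w : 0 < x -> Re (ppow x w) = x `^ Re w * cos (Im w * ln x).
Proof.
move=> x0; rewrite ppow_gt0// /powR gt_eqF//; case: w => u v.
by rewrite /cexp/= !mulr0 subr0 add0r !mul0r subr0.
Qed.

Lemma Im_ppow x w : 0 < x -> Im (ppow x w) = x `^ Re w * sin (Im w * ln x).
Proof.
move=> x0; rewrite ppow_gt0// /powR gt_eqF//; case: w => u v.
by rewrite /cexp/= !mulr0 subr0 add0r !mul0r addr0.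
Qed.

Lemma Re_gtN1_neq0 w : -1 < Re w -> w + 1 != 0.
Proof.
case: w => u v /= u1; rewrite eq_complex negb_and/=; apply/orP; left.
by rewrite lt0r_neq0//; lra.
Qed.

(* The value [1/2] at [0] makes [step t + step (- t) = 1] hold for every [t]. *)
Definition step (t : R) : R := (Num.sg t + 1) / 2.

Lemma step_gt0 t : 0 < t -> step t = 1.
Proof. by move=> t0; rewrite /step gtr0_sg// divff. Qed.

Lemma step_lt0 t : t < 0 -> step t = 0.
Proof. by move=> t0; rewrite /step ltr0_sg// addNr mul0r. Qed.

Lemma stepN t : step (- t) = 1 - step t.
Proof. by rewrite /step sgrN; field. Qed.

(* Also asserting the integral of the reflected function lets one induction
   serve both half-lines. *)
Definition has_cintegral2 (f : R -> R[i]) (v : R[i]) :=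
  has_cintegral f v /\ has_cintegral (fun x => f (- x)) v.

(** For a <= 0 integrand and value vanish. Otherwise the integrand is x^w on (0, a), up to the
    single point a, and the real closed forms assemble into a^(w+1) / (w+1). *)
Lemma has_cintegral2_ppow_step a w : -1 < Re w ->
  has_cintegral2 (fun x => ppow x w * (step (a - x))%:C)
    (ppow a (w + 1) / (w + 1)).
Proof.
move=> w1.
have [a0|a0] := leP a 0.
  have f0 x : ppow x w * (step (a - x))%:C = 0.
    have [x0|x0] := leP x 0; first by rewrite ppow_le0// mul0r.
    by rewrite step_lt0 ?mulr0//; lra.
  have -> : (fun x => ppow x w * (step (a - x))%:C) = (fun=> 0) by exact/funext.
  by rewrite ppow_le0// mul0r; split; exact: has_cintegral0.
have fE x : (if x \in `]0, a[%classic then ppow x w else 0) +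
    (if x == a then ppow a w / 2 else 0) = ppow x w * (step (a - x))%:C.
  have -> : (x \in `]0, a[%classic) = (0 < x < a) by rewrite mem_setE in_itv.
  have [x0|x0] := leP x 0.
    rewrite (ppow_le0 _ x0) mul0r /= ifF ?addr0//.
    by rewrite lt_eqF// (le_lt_trans x0).
  have [xa|xa|->] := ltgtP x a.
  - by rewrite step_gt0 ?subr_gt0// mulr1 addr0.
  - by rewrite step_lt0 ?subr_lt0// mulr0 addr0.
  - by rewrite subrr /step sgr0 !add0r mul1r fmorphV rmorph_nat.
(* The coefficient pairs (1, 0) and (0, 1) select the real and the imaginary part of x^w. *)
have [iC [iC' [IC IC']]] := integral_powR_cos_sin (Im w) 1 0 w1 a0.
have [iS [iS' [IS IS']]] := integral_powR_cos_sin (Im w) 0 1 w1 a0.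
have RE x : 0 < x -> Re (ppow x w) =
    x `^ Re w * (1 * cos (Im w * ln x) + 0 * sin (Im w * ln x)).
  by move=> x0; rewrite Re_ppow// mul1r mul0r addr0.
have IE x : 0 < x -> Im (ppow x w) =
    x `^ Re w * (0 * cos (Im w * ln x) + 1 * sin (Im w * ln x)).
  by move=> x0; rewrite Im_ppow// mul1r mul0r add0r.
have itv0 x : x \in `]0, a[%classic -> 0 < x.
  by rewrite inE /= in_itv/= => /andP[].
have itvN x : x \in `]- a, 0[%classic -> 0 < - x.
  by rewrite inE /= in_itv/= oppr_gt0 => /andP[].
have RI : \int[mu]_(x in `]0, a[) Re (ppow x w) = \int[mu]_(x in `]0, a[)
    (x `^ Re w * (1 * cos (Im w * ln x) + 0 * sin (Im w * ln x))).
  by apply: eq_Rintegral => x /itv0/RE.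
have II : \int[mu]_(x in `]0, a[) Im (ppow x w) = \int[mu]_(x in `]0, a[)
    (x `^ Re w * (0 * cos (Im w * ln x) + 1 * sin (Im w * ln x))).
  by apply: eq_Rintegral => x /itv0/IE.
have RI' : \int[mu]_(x in `]- a, 0[) Re (ppow (- x) w) =
    \int[mu]_(x in `]- a, 0[)
    ((- x) `^ Re w * (1 * cos (Im w * ln (- x)) + 0 * sin (Im w * ln (- x)))).
  by apply: eq_Rintegral => x /itvN/RE.
have II' : \int[mu]_(x in `]- a, 0[) Im (ppow (- x) w) =
    \int[mu]_(x in `]- a, 0[)
    ((- x) `^ Re w * (0 * cos (Im w * ln (- x)) + 1 * sin (Im w * ln (- x)))).
  by apply: eq_Rintegral => x /itvN/IE.
have VE : ppow a (w + 1) / (w + 1) =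
    \int[mu]_(x in `]0, a[) Re (ppow x w) +i*
    \int[mu]_(x in `]0, a[) Im (ppow x w).
  rewrite RI II IC IS.
  apply: (mulIf (Re_gtN1_neq0 w1)); rewrite divfK ?Re_gtN1_neq0//.
  apply/eqP; rewrite eq_complex Re_ppow// Im_ppow//.
  case: (w) w1 => u v /= u1; rewrite addr0.
  have D0 : (u + 1) ^+ 2 + v ^+ 2 != 0.
    by rewrite lt0r_neq0// ltr_pwDl ?sqr_ge0// exprn_gt0// -ltrBlDr sub0r.
  by apply/andP; split; apply/eqP; field.
have VE' : ppow a (w + 1) / (w + 1) =
    \int[mu]_(x in `]- a, 0[) Re (ppow (- x) w) +i*
    \int[mu]_(x in `]- a, 0[) Im (ppow (- x) w).
  by rewrite VE RI II IC IS RI' II' IC' IS'.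
split.
- rewrite -[_ / _]addr0; apply: has_cintegral_eq fE _ _; first by [].
  apply: has_cintegralD; last exact: has_cintegral_point.
  rewrite VE; apply: has_cintegral_restrict => //.
    by apply: eq_integrable iC => // x /itv0 x0 /=; rewrite RE.
  by apply: eq_integrable iS => // x /itv0 x0 /=; rewrite IE.
- rewrite -[_ / _]addr0.
  apply: has_cintegral_eq (fun x => fE (- x)) _ _; first by [].
  apply: has_cintegralD.
    apply: (@has_cintegral_eq _ (fun x =>
      if x \in `]- a, 0[%classic then ppow (- x) w else 0)); [|by []|].
      move=> x.
      have -> // : (- x \in `]0, a[%classic) = (x \in `]- a, 0[%classic).
      by rewrite !mem_setE !in_itv/= oppr_gt0 ltrNl andbC.
    rewrite VE'; apply: has_cintegral_restrict => //.
      by apply: eq_integrable iC' => // x /itvN x0 /=; rewrite RE.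
    by apply: eq_integrable iS' => // x /itvN x0 /=; rewrite IE.
  apply: (@has_cintegral_eq _ (fun x =>
    if x == - a then ppow a w / 2 else 0)); [|by []|].
    by move=> x; rewrite eqr_oppLR.
  exact: has_cintegral_point.
Qed.
End complex_power.

(** * The beta integral with an integer second argument *)

Section beta.
Context {R : realType}.
Implicit Types (x a : R) (w : R[i]).

Lemma has_cintegral2D (f g : R -> R[i]) v w :
  has_cintegral2 f v -> has_cintegral2 g w ->
  has_cintegral2 (fun x => f x + g x) (v + w).
Proof. by move=> [f1 f2] [g1 g2]; split; exact: has_cintegralD. Qed.

Lemma has_cintegral2Z (f : R -> R[i]) v (c : R[i]) : has_cintegral2 f v ->
  has_cintegral2 (fun x => c * f x) (c * v).
Proof. by move=> [f1 f2]; split; exact: has_cintegralZ. Qed.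

Lemma has_cintegral2_eq (f g : R -> R[i]) v w : f =1 g -> v = w ->
  has_cintegral2 f v -> has_cintegral2 g w.
Proof. by move=> /funext -> ->. Qed.

Lemma addnS_Re_gtN1_neq0 (k : nat) w : -1 < Re w -> w + k.+1%:R != 0.
Proof.
move=> w1; rewrite -natr1 addrA; apply: Re_gtN1_neq0.
elim: k => [|k]; first by rewrite addr0.
by rewrite -natr1 addrA; case: (w + k%:R) => u v /=; lra.
Qed.

(** The value is a^(w+m+1) B(w+1, m+1) for a > 0, with the gamma quotient written as a finite
    product. The induction keeps [w] general because its second term has exponent w + 1. *)
Lemma has_cintegral2_beta (m : nat) a w : -1 < Re w ->
  has_cintegral2 (fun x => ppow x w * (step (a - x))%:C * (a - x)%:C ^+ m)
    (ppow a (w + m.+1%:R) * m`!%:R / \prod_(i < m.+1) (w + i.+1%:R)).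
Proof.
elim: m w => [|m IH] w w1.
  apply: has_cintegral2_eq (has_cintegral2_ppow_step a w1) => [x|].
    by rewrite expr0 mulr1.
  by rewrite big_ord_recl big_ord0 fact0 !mulr1.
have w2 : -1 < Re (w + 1) by case: w w1 => u v /=; lra.
apply: has_cintegral2_eq (has_cintegral2D (has_cintegral2Z a%:C (IH _ w1))
    (has_cintegral2Z (-1) (IH _ w2))) => [x|].
  by rewrite ppowD1 exprS rmorphB /=; ring.
have -> : w + 1 + m.+1%:R = w + m.+2%:R by rewrite -addrA nat1r.
have -> : w + m.+2%:R = w + m.+1%:R + 1 by rewrite -addrA natr1.
rewrite ppowD1.
set A := a%:C; set B := ppow _ _.
set P := \prod_(i < m.+1) (w + i.+1%:R).
set Q := \prod_(i < m.+1) (w + 1 + i.+1%:R).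
set T := \prod_(i < m.+2) (w + i.+1%:R).
have neq0 k := addnS_Re_gtN1_neq0 k w1.
have TP : T = P * (w + m.+2%:R) by rewrite /T big_ord_recr.
have TQ : T = (w + 1) * Q.
  rewrite /T big_ord_recl; congr (_ * _); apply: eq_bigr => i _.
  by rewrite lift0 -addrA nat1r.
have P0 : P != 0 by apply/prodf_neq0 => i _.
have Q0 : Q != 0.
  by apply/prodf_neq0 => i _; rewrite -addrA nat1r.
have T0 : T != 0 by apply/prodf_neq0 => i _.
(* Over the common denominator [T] the numerators differ by (w+m+2) - (w+1) = m+1, which turns m!
   into (m+1)!. *)
have -> : P^-1 = (w + m.+2%:R) / T.
  by rewrite TP invfM mulrA mulrAC divff ?mul1r.
have -> : Q^-1 = (w + 1) / T.
  by rewrite TQ invfM mulrA divff ?mul1r// Re_gtN1_neq0.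
by rewrite factS natrM -[m.+2%:R]natr1; field.
Qed.
End beta.

(** * Rigidity of logarithm branches on each half-line *)

Section log_branch.
Context {R : realType}.
Variable (L : R -> R[i]) (hL : is_log_branch L).

(** The imaginary part of exp(L x) = x forces the sine to vanish, so the cosine is 1 or -1; the
    modulus then gives the real part and the sign gives the cosine. *)
Let Lpolar x : x != 0 ->
  [/\ Re (L x) = ln `|x|, cos (Im (L x)) = Num.sg x & sin (Im (L x)) = 0].
Proof.
move=> x0; have [+ _] := hL x0; rewrite /cexp; case: (L x) => u v /=.
move=> /eqP; rewrite eq_complex /= !mul0r subr0 addr0 => /andP[/eqP C /eqP S].
have S0 : sin v = 0.
  by move/eqP: S; rewrite mulf_eq0 gt_eqF ?expR_gt0//= => /eqP.
have EX : expR u = `|x|.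
  rewrite -[LHS]ger0_norm ?expR_ge0// -C normrM.
  suff -> : `|cos v| = 1 by rewrite mulr1.
  have := cos2Dsin2 v; rewrite S0 expr0n addr0 => /eqP.
  by rewrite sqr_norm_eq1 => /eqP.
split => //.
  by rewrite -EX expRK.
have xn0 : `|x| != 0 by rewrite normr_eq0.
apply: (mulfI xn0); rewrite -{1}EX C.
by rewrite [RHS]mulrC -numEsg.
Qed.

(** Near x the sign is constant, so the difference of the imaginary parts has cosine 1. By
    continuity it is below 1 < pi in absolute value, where the cosine is injective, hence it is
    0. *)
Let Im_near x : x != 0 -> \forall y \near x, Im (L y) = Im (L x).
Proof.
move=> x0; have [_ Lx] := hL x0.
have [_ cx sx] := Lpolar x0.
have sxy : \forall y \near x, Num.sg y = Num.sg x.
  move: x0; rewrite neq_lt => /orP[x0|x0]; near=> y.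
    by rewrite !ltr0_sg//; near: y; exact: lt_nbhsl.
  by rewrite !gtr0_sg//; near: y; exact: lt_nbhsr.
have dist : \forall y \near x, `|L x - L y| < (1 : R[i]).
  exact: (@cvgr_dist_lt _ _ _ _ _ _ _ Lx _ ltr01).
near=> y.
have sy : Num.sg y = Num.sg x by near: y.
have y0 : y != 0 by rewrite -sgr_eq0 sy sgr_eq0.
have [_ cy sy'] := Lpolar y0.
have /= d : `|L x - L y| < 1 by near: y.
have {}d : `|Im (L x) - Im (L y)| < 1.
  move: d; rewrite normc_def (ltcR _ 1); apply: le_lt_trans.
  case: (L x) (L y) => u v [u' v'] /=.
  by rewrite -sqrtr_sqr ler_wsqrtr// lerDr sqr_ge0.
have : cos `|Im (L x) - Im (L y)| = cos 0.
  by rewrite cos_norm cosB cx cy sx sy' sy mulr0 addr0 cos0 -expr2 sqr_sg x0.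
move/cos_inj; rewrite !in_itv/= normr_ge0/= lexx pi_ge0/=.
rewrite (ltW (lt_le_trans d _)) ?(le_trans _ (pi_ge2 _)) ?ler1n//.
by move=> /(_ isT isT)/eqP; rewrite normr_eq0 subr_eq0 => /eqP.
Unshelve. all: by end_near. Qed.

(** Two points of equal sign bound an interval that avoids 0; there the imaginary part is locally
    constant, so its derivative is 0 and the mean value theorem applies. *)
Let Im_const x y : 0 < x * y -> Im (L x) = Im (L y).
Proof.
wlog xy : x y / x < y.
  move=> H xy0; have [xy|yx|->//] := ltgtP x y; first exact: H.
  by apply/esym/H => //; rewrite mulrC.
move=> xy0.
have n0 z : z \in `[x, y] -> z != 0.
  rewrite in_itv/= => /andP[xz zy]; apply/eqP => z0; rewrite z0 in xz zy.
  by move: xy0; rewrite ltNge mulr_le0_ge0.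
have dI z : z != 0 -> is_derive z (1 : R) (fun t => Im (L t)) 0.
  move=> z0; apply: (@near_eq_is_derive R R R (cst (Im (L z)))).
    by near=> t; apply/esym; near: t; exact: Im_near.
have [z zxy||c _] := @MVT R (fun t => Im (L t)) (cst 0) x y xy.
- by apply/dI/n0; exact: subset_itv_oo_cc zxy.
- by apply: derivable_within_continuous => z /n0/dI.
- by rewrite mul0r => /eqP; rewrite subr_eq0 => /eqP.
Unshelve. all: by end_near. Qed.

Let LE x y : 0 < x * y -> `|y| = 1 -> L x = (ln `|x|)%:C + L y.
Proof.
move=> xy y1; have y0 : y != 0 by rewrite -normr_eq0 y1 oner_eq0.
have x0 : x != 0 by apply: contraTN xy => /eqP ->; rewrite mul0r ltxx.
have [Rx _ _] := Lpolar x0; have [Ry _ _] := Lpolar y0.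
apply/eqP; rewrite eq_complex; move: Rx Ry (Im_const xy).
case: (L x) (L y) => u v [u' v'] /= -> ->.
by rewrite y1 ln1 addr0 add0r eqxx => ->; rewrite eqxx.
Qed.

Lemma cpow_log_branchE x w : cpow L x w =
  cexp (w * L 1) * ppow x w + cexp (w * L (-1)) * ppow (- x) w.
Proof.
rewrite /cpow; case: (ltgtP x 0) => [x0|x0|->].
- rewrite (ppow_le0 _ (ltW x0)) mulr0 add0r ppow_gt0 ?oppr_gt0//.
  rewrite (@LE x (-1)) ?mulrN1 ?oppr_gt0 ?normrN1//.
  by rewrite -cexpD ltr0_norm// mulrDr addrC.
- rewrite (@ppow_le0 _ (- x)) ?oppr_le0 ?ltW// mulr0 addr0 ppow_gt0//.
  rewrite (@LE x 1) ?mulr1 ?normr1//.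
  by rewrite -cexpD gtr0_norm// mulrDr addrC.
- by rewrite oppr0 !ppow_le0// !mulr0 addr0.
Qed.

(** Since exp(L x) = x, an integer shift of the exponent does not depend on the branch. *)
Lemma cexp_log_branchMnD x w (n : nat) : x != 0 ->
  cexp ((w + n%:R) * L x) = cexp (w * L x) * x%:C ^+ n.
Proof. by move=> /hL[Lx _]; rewrite mulrDl cexpD cexpMn Lx. Qed.

End log_branch.

(** * The spline *)

Section spline.
Context {R : realType} {m : nat} {a : 'I_m.+2 -> R} (aI : injective a).
Implicit Types (x : R) (z : R[i]).
(** Weights of the divided difference at n = m + 2 nodes. *)
Let c (j : 'I_m.+2) := (\prod_(k < m.+2 | k != j) (a j - a k))^-1.

Lemma sum_divided_power x : \sum_(j < m.+2) (a j - x) ^+ m * c j = 0.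
Proof.
have := @divided_difference_poly _ m.+1 a aI (('X - x%:P) ^+ m).
rewrite size_exp_XsubC leqnn => /(_ isT); apply: etrans.
by apply: eq_bigr => j _; rewrite horner_exp hornerXsubC.
Qed.

(** Here |t| t^(n-3) = sg(t) t^(n-2), and replacing sg by 2 [step] - 1 costs only the vanishing
    sum. *)
Lemma splineE x : spline a x =
  m.+1%:R * \sum_(j < m.+2) step (a j - x) * (a j - x) ^+ m * c j.
Proof.
rewrite /spline -[m.+2%:R]natr1 addrK -mulrA; congr (_ * _).
have -> : \sum_(j < m.+2) step (a j - x) * (a j - x) ^+ m * c j =
    2^-1 * \sum_(j < m.+2) Num.sg (a j - x) * (a j - x) ^+ m * c j +
    2^-1 * \sum_(j < m.+2) (a j - x) ^+ m * c j.
  rewrite -mulrDr -big_split mulr_sumr; apply: eq_bigr => j _ /=.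
  by rewrite /step; field.
rewrite sum_divided_power mulr0 addr0; congr (_ * _); apply: eq_bigr => j _.
congr (_ / _); set t := a j - x.
(* At t = 0 the factors |t| and sg(t) vanish, whatever value the possibly negative power takes. *)
have [->|t0] := eqVneq t 0; first by rewrite normr0 sgr0 !mul0r.
have -> : t ^+ m = t * t ^ (m.+2%:Z - 3).
  have -> : m.+2%:Z - 3 = m%:Z - 1 by rewrite -addn2 PoszD -addrA.
  by rewrite expfzDr// mulrCA divff// mulr1.
by rewrite mulrA -normrEsg.
Qed.

Lemma splineEN x : spline a x =
  - m.+1%:R * \sum_(j < m.+2) step (x - a j) * (a j - x) ^+ m * c j.
Proof.
have -> : \sum_(j < m.+2) step (x - a j) * (a j - x) ^+ m * c j =
    \sum_(j < m.+2) (a j - x) ^+ m * c j -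
    \sum_(j < m.+2) step (a j - x) * (a j - x) ^+ m * c j.
  rewrite -sumrB; apply: eq_bigr => j _.
  by rewrite -(opprB (a j) x) stepN; ring.
by rewrite sum_divided_power sub0r mulrNN splineE.
Qed.

Lemma frac_hsymE (L : R -> R[i]) z : frac_hsym a L z =
  \sum_(j < m.+2) cpow L (a j) (z + m.+1%:R) * (c j)%:C.
Proof.
have aCI : injective (fun j => (a j)%:C).
  by move=> i j /complexI/aI.
have E : \det (frac_vandermonde a L z) =
    (\sum_(j < m.+2) cpow L (a j) (z + m.+1%:R) * (c j)%:C) *
    (vandermonde_prod a)%:C.
  have := det_vandermonde_last aCI (fun j => cpow L (a j) (z + m.+1%:R)).
  have -> : z + m.+1%:R = z + m.+2%:R - 1.
    by rewrite -[m.+2%:R]natr1 addrA addrK.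
  move=> ->; congr (_ * _).
    apply: eq_bigr => i _; congr (_ * _); rewrite /c fmorphV rmorph_prod.
    by congr (_^-1); apply: eq_bigr => k _; rewrite rmorphB.
  rewrite rmorph_prod; apply: eq_bigr => i _; rewrite rmorph_prod.
  by apply: eq_bigr => k _; rewrite rmorphB.
rewrite /frac_hsym E mulfK// fmorph_eq0.
apply/prodf_neq0 => i _; apply/prodf_neq0 => j ij.
by rewrite subr_eq0 inj_eq// -val_eqE /= gtn_eqF.
Qed.

Lemma cbinomE z : cbinom (z + m.+1%:R) m.+1 =
  (\prod_(i < m.+1) (z + i.+1%:R)) / (m.+1)`!%:R.
Proof.
rewrite /cbinom; congr (_ / _).
rewrite [RHS](reindex_inj rev_ord_inj); apply: eq_bigr => i _ /=.
rewrite -addrA; congr (_ + _).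
have im : (i <= m)%N by rewrite -ltnS.
by rewrite subSS -subSn// natrB// ltnW.
Qed.

End spline.

(** * Integration of the spline against the power, node by node *)

Theorem theorem1 (R : realType) (L : R -> R[i]) (hL : is_log_branch L)
    (n : nat) (hn : (2 <= n)%N) (a : 'I_n -> R)
    (ha : forall i j : 'I_n, (i < j)%N -> a i < a j)
    (z : R[i]) (hz : -1 < complex.Re z) :
  cintegrable (fun x => cpow L x z * (spline a x)%:C) /\
  frac_hsym a L z =
    cbinom (z + n%:R - 1) n.-1 *
    cintegral (fun x => cpow L x z * (spline a x)%:C).
Proof.
case: n hn a ha => [//|[//|m]] _ a ha.
have aI : injective a.
  move=> i j aij; apply/val_inj; case: (ltngtP i j) => // /ha.
    by rewrite aij ltxx.
  by rewrite aij ltxx.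
pose c (j : 'I_m.+2) := (\prod_(k < m.+2 | k != j) (a j - a k))^-1.
pose K : R[i] := cexp (z * L 1); pose K' : R[i] := cexp (z * L (-1)).
pose pos (b x : R) : R[i] := ppow x z * (step (b - x))%:C * (b - x)%:C ^+ m.
pose P := \prod_(i < m.+1) (z + i.+1%:R).
(* On the negative side the sign collects one -1 from [splineEN] and m from (a_j - x)^m = (-1)^m
   (-a_j - (-x))^m. *)
pose term j x := m.+1%:R * (c j)%:C *
  (K * pos (a j) x + (- 1) ^+ m.+1 * K' * pos (- a j) (- x)).
have termE x : \sum_(j < m.+2) term j x = cpow L x z * (spline a x)%:C.
  rewrite cpow_log_branchE// mulrDl {1}(splineE aI) (splineEN aI).
  rewrite !rmorphM !rmorph_sum rmorphN !rmorph_nat !mulr_sumr -big_split.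
  apply: eq_bigr => j _; rewrite /term /pos -/K -/K' /= !rmorphM !rmorphXn.
  have -> : - a j - - x = - (a j - x) by ring.
  have -> : x - a j = - (a j - x) by ring.
  rewrite (rmorphN _ (a j - x)) /= [(- (a j - x)%:C) ^+ m]exprNn exprS.
  have S2 : ((-1) ^+ m * (-1) ^+ m : R[i]) = 1 by rewrite -expr2 sqrr_sign.
  ring: S2.
have termI j : has_cintegral (term j)
    (cpow L (a j) (z + m.+1%:R) * (c j)%:C * ((m.+1)`!%:R / P)).
  have [pI _] := has_cintegral2_beta m (a j) hz.
  have [_ nI] := has_cintegral2_beta m (- a j) hz.
  apply: has_cintegral_eq (has_cintegralZ (m.+1%:R * (c j)%:C)
    (has_cintegralD (has_cintegralZ K pI)
      (has_cintegralZ ((- 1) ^+ m.+1 * K') nI))) => //.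
  (* Raising the exponent by m + 1 multiplies the constant at -1 by (-1)^(m+1), exactly the sign in
     [term], so the two halves recombine into one power of a_j. *)
  rewrite cpow_log_branchE// !cexp_log_branchMnD ?oppr_eq0 ?oner_eq0//.
  rewrite -/K -/K' -/P.
  rewrite rmorph1 expr1n rmorphN1 factS natrM; ring.
have hI := @has_cintegral_sum _ _ (index_enum _) xpredT _ _
  (fun j _ => termI j).
have {}hI : has_cintegral (fun x => cpow L x z * (spline a x)%:C)
    (frac_hsym a L z * ((m.+1)`!%:R / P)).
  apply: has_cintegral_eq hI => //.
  by rewrite frac_hsymE// mulr_suml.
split; first exact: has_cintegral_cintegrable hI.
have [_ _ ->] := hI.
have -> : z + m.+2%:R - 1 = z + m.+1%:R.
  by rewrite -[m.+2%:R]natr1 addrA addrK.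
(* [P] is nonzero because Re z > -1, so the binomial coefficient cancels its inverse. *)
rewrite cbinomE -/P mulrCA; have P0 : P != 0.
  by apply/prodf_neq0 => i _; exact: addnS_Re_gtN1_neq0.
by rewrite [P / _ * _]mulrA divfK ?divff ?mulr1// pnatr_eq0 -lt0n fact_gt0.
Qed.
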